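(* Let $m,\alpha$ be positive integers and let $F\in \mathrm{Char}(m,\alpha)$. Then $\det(F)\in \mathrm{Char}(m,1)$, where $\det(F)$ is the function $S\mapsto\det(F(S))$.
   Context: $\mathrm{U}(n)$ is the group of unitary $n\times n$ matrices and $1_n$ the unit matrix of order $n$. $\mathrm{B}_n$ is the set of complex $n\times n$ matrices $z$ with Euclidean operator norm $\|z\|<1$. Characteristic functions: for an integer $j\ge 0$, let $g=\begin{pmatrix}a&b\\c&d\end{pmatrix}\in \mathrm{U}(\alpha+mj)$, with $a$ of size $\alpha\times\alpha$ and $d$ of size $mj\times mj$. For $S=(s_{\mu\nu})\in \mathrm{B}_m$ let $1_j\otimes S$ denote the $mj\times mj$ block matrix with $m\times m$ blocks, whose $(\mu,\nu)$ block is $s_{\mu\nu}1_j$. Put $$\Theta[g;S]=a+b\,(1_j\otimes S)\bigl(1_{mj}-d\,(1_j\otimes S)\bigr)^{-1}c .$$ (For $j=0$ this is the constant $a$.) $\mathrm{Char}(m,\alpha)$ is the set of all functions $S\mapsto \Theta[g;S]$ on $\mathrm{B}_m$, where $g\in \mathrm{U}(\alpha+mj)$ and $j=0,1,2,\dots$. *)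

(* Defs.v *)
From HB Require Import structures.
From mathcomp Require Import all_boot all_order all_algebra.
From mathcomp Require Import complex mxtens.
From mathcomp Require Import all_classical all_reals.

Set Implicit Arguments.
Unset Strict Implicit.
Unset Printing Implicit Defensive.

Import Order.TTheory GRing.Theory Num.Theory.

Local Open Scope classical_set_scope.
Local Open Scope ring_scope.

Section CharacteristicFunctions.
Variable R : realType.
Local Notation C := R[i].

Definition l2norm n (v : 'cV[C]_n) : R :=
  Num.sqrt (\sum_(i < n) Normc.normc (v i 0) ^+ 2).

Definition opnorm n (z : 'M[C]_n) : R :=
  sup [set l2norm (z *m v) | v in [set v | l2norm v <= 1]].

Definition Bset n : set 'M[C]_n := [set z | opnorm z < 1].
Arguments Bset : clear implicits.

(* [S *t 1%:M] is the block matrix whose (mu, nu) block is [S mu nu *: 1_j];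
   it is the matrix often written 1_j (x) S, with the factors in the other
   order.  [invmx] is only ever applied to an invertible matrix when g is
   unitary and S lies in [Bset m]. *)
Definition Theta m alpha j (g : 'M[C]_(alpha + m * j)) (S : 'M[C]_m) :
    'M[C]_alpha :=
  let a := ulsubmx g in
  let b := ursubmx g in
  let c := dlsubmx g in
  let d := drsubmx g in
  let S' := S *t (1%:M : 'M[C]_j) in
  a + b *m S' *m invmx (1%:M - d *m S') *m c.

(* The domain is the subtype of the points of [Bset m], so that members of
   [Char m alpha] are functions on the ball and nowhere else. *)
Definition Char m alpha : set (Bset m -> 'M[C]_alpha) :=
  [set F | exists j (g : 'M[C]_(alpha + m * j)),
     g \is unitarymx /\ F = fun S => Theta g (\val S)].

End CharacteristicFunctions.

Arguments Bset : clear implicits.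
Arguments Char : clear implicits.

(* Main.v *)
Require Import Defs.
From HB Require Import structures.
From mathcomp Require Import all_boot all_order all_algebra all_fingroup.
From mathcomp Require Import complex mxtens.
From mathcomp Require Import all_classical all_reals.

(** Write A' for the conjugate transpose.  The proof goes through Agler
    decompositions: F lies in Char(m, alpha) exactly when there are finitely
    many functions H_k on the ball, with values in alpha x m matrices, such
    that

      1 - F(S) F(T)' = sum_k H_k(S) (1 - S T') H_k(T)'

    for all S and T ([agler]).  This condition does not mention g, which is
    what makes it easy to transport from F to det F.

    From a unitary g one gets the decomposition because the internal state
    G = b (1 - E d)^-1, with E = S (x) 1_j, satisfies (1, G E) g = (F, G);
    taking Gram matrices and cutting G into j slices gives the identity
    ([agler_transfer]).  Conversely the decomposition says that the two
    families (1, G E) and (F, G) have the same Gram matrices, so that some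
    unitary g maps one to the other (the lurking isometry argument,
    [lurking_isometry]), and eliminating G from (1, G E) g = (F, G) gives back
    F = Theta[g; S] ([transfer_agler]).  Since only finitely many H_k occur,
    g is a finite matrix.  Both directions need 1 - d E to be invertible,
    which follows from S being a strict contraction ([resolvent_unit],
    [ball_contraction]).

    It remains to decompose 1 - det F(S) conj(det F(T)) = 1 - det A, where
    A = F(S) F(T)' ([agler_det]).  In terms of the n-th tensor power, det F
    is the action of F (x) ... (x) F on the alternating vector v, and
    1 - A (x) ... (x) A telescopes into the sum over k of
    A (x) ... (x) A (x) (1 - A) (x) 1 (x) ... (x) 1 with 1 - A in position k.
    Every factor is a Gram product: A = F(S) F(T)' and 1 = 1 1' trivially,
    and 1 - A by hypothesis, through 1 - S T'.  Compressing to v keeps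
    this form.  With coordinates, v turns into a double sum over
    permutations divided by n!.  Because only the Agler identity has to
    survive, the compression to v costs nothing, whereas restricting a
    unitary g to a block of F would destroy its unitarity. *)

Set Implicit Arguments.
Unset Strict Implicit.
Unset Printing Implicit Defensive.

Import Order.TTheory GRing.Theory Num.Theory.

Local Open Scope classical_set_scope.
Local Open Scope ring_scope.
Local Open Scope sesquilinear_scope.

(** * Unitary extension of isometries *)

Section Isometry.
Variable C : numClosedFieldType.

Lemma adjmx_mul m n p (A : 'M[C]_(m, n)) (B : 'M[C]_(n, p)) :
  (A *m B)^t* = B^t* *m A^t*.
Proof. by rewrite trmx_mul map_mxM. Qed.

Lemma adjmxB m n (A B : 'M[C]_(m, n)) : (A - B)^t* = A^t* - B^t*.
Proof. by rewrite linearB /= map_mxB. Qed.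

Lemma adj_row_mx m n p (A : 'M[C]_(m, n)) (B : 'M[C]_(m, p)) :
  (row_mx A B)^t* = col_mx (A^t*) (B^t*).
Proof. by rewrite tr_row_mx map_col_mx. Qed.

Lemma adj_col_mx m n p (A : 'M[C]_(m, p)) (B : 'M[C]_(n, p)) :
  (col_mx A B)^t* = row_mx (A^t*) (B^t*).
Proof. by rewrite tr_col_mx map_row_mx. Qed.

Lemma gram_eq0 m n (A : 'M[C]_(m, n)) : A *m A^t* = 0 -> A = 0.
Proof.
move=> A0; apply/matrixP=> i j; rewrite mxE.
have /eqP : (A *m A^t*) i i = 0 by rewrite A0 mxE.
rewrite mxE psumr_eq0 => [|k _]; last by rewrite !mxE mul_conjC_ge0.
by move=> /allP/(_ j (mem_index_enum _)); rewrite !mxE mul_conjC_eq0 => /eqP.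
Qed.

(** Since A has fewer rows than columns, A' has a nonzero left kernel; any
    normalized vector of it will do. *)
Lemma unitary_extend r n (A : 'M[C]_(r, n)) : (r < n)%N -> A \is unitarymx ->
  exists a : 'rV[C]_n, col_mx A a \is unitarymx.
Proof.
move=> rn Au.
have : kermx (A^t*) != 0.
  rewrite -mxrank_eq0 mxrank_ker -lt0n subn_gt0 (leq_ltn_trans _ rn) //.
  exact: rank_leq_col.
case/rowV0Pn=> x /sub_kermxP xA x0.
have Ax : A *m x^t* = 0.
  by rewrite -[LHS]trmxCK adjmx_mul trmxCK xA trmx0 map_mx0.
pose q := (x *m x^t*) 0 0.
have q_gt0 : 0 < q.
  rewrite lt0r; apply/andP; split; last first.
    by rewrite /q mxE sumr_ge0 // => k _; rewrite !mxE mul_conjC_ge0.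
  apply: contra x0 => /eqP q0; apply/eqP/gram_eq0.
  by apply/matrixP=> i j; rewrite !ord1 [LHS]q0 mxE.
exists ((sqrtC q)^-1 *: x); apply/unitarymxP.
rewrite adj_col_mx mul_col_row (unitarymxP Au) linearZ /= map_mxZ.
rewrite -!scalemxAr -!scalemxAl xA Ax !scaler0 scalerA.
rewrite [x *m _]mx11_scalar -/q scale_scalar_mx.
rewrite [X in (X / _ * _)%:M](_ : _ = (sqrtC q)^-1); last first.
  by apply: conj_Creal; rewrite realV realE sqrtC_ge0 ltW.
by rewrite -invfM -expr2 sqrtCK mulVf ?gt_eqF // -scalar_mx_block.
Qed.

(** Completing A and B, one row at a time, to square unitaries reduces the
    claim to W = A' B. *)
Lemma unitary_transport r n (A B : 'M[C]_(r, n)) :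
  A \is unitarymx -> B \is unitarymx ->
  exists2 W : 'M[C]_n, W \is unitarymx & A *m W = B.
Proof.
move=> Au Bu; have rn : (r <= n)%N by rewrite -(mxrank_unitary Au) rank_leq_col.
have [k kE] : exists k, n = (r + k)%N by exists (n - r)%N; rewrite subnKC.
elim: k r A B Au Bu rn kE => [|k IH] r A B Au Bu rn kE.
  have {rn}rn : r = n by rewrite kE addn0.
  subst r; exists (A^t* *m B).
    by rewrite mul_unitarymx // trmxC_unitary.
  by rewrite mulmxA (unitarymxP Au) mul1mx.
have ltrn : (r < n)%N by rewrite kE addnS ltnS leq_addr.
have [a Aa] := unitary_extend ltrn Au; have [b Bb] := unitary_extend ltrn Bu.
have [||W Wu] := IH _ _ _ Aa Bb; rewrite ?addn1 ?addSnnS //.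
by rewrite mul_col_mx => /eq_col_mx[AW _]; exists W.
Qed.

(** Writing A = L Q with Q orthonormal and L invertible, equality of the Gram
    matrices makes L^-1 B orthonormal too, so that Q can be carried to it. *)
Lemma row_free_isometry r n (A B : 'M[C]_(r, n)) :
  row_free A -> A *m A^t* = B *m B^t* ->
  exists2 W : 'M[C]_n, W \is unitarymx & A *m W = B.
Proof.
move=> freeA AB.
have rn : (r <= n)%N by rewrite -(eqP freeA) rank_leq_col.
pose Q := schmidt A.
have Qu : Q \is unitarymx := schmidt_unitarymx A rn.
have [L AE] : exists L, A = L *m Q by apply/submxP; rewrite eqmx_schmidt_free.
have Lu : L \in unitmx.
  rewrite -row_free_unit /row_free eqn_leq rank_leq_row -{1}(eqP freeA) AE.
  exact: mxrankM_maxl.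
pose Q' := invmx L *m B.
have Q'u : Q' \is unitarymx.
  apply/unitarymxP; rewrite adjmx_mul mulmxA -[_ *m B *m _]mulmxA -AB AE.
  rewrite adjmx_mul !mulmxA mulVmx // mul1mx (unitarymxP Qu).
  by rewrite mul1mx -adjmx_mul mulVmx // trmx1 map_mx1.
have BE : B = L *m Q' by rewrite mulKVmx.
have [W Wu QW] := unitary_transport Qu Q'u.
by exists W => //; rewrite AE -mulmxA QW -BE.
Qed.

(** Instead of choosing a basis among infinitely many vectors, take a pair
    (A, B) with A row free of maximal height r <= n such that A A' = B B' and
    A (u s)' = B (v s)' for all s.  By maximality every u s is a combination
    X A; then v s - X B has Gram matrix 0, so that v s = X B, and any unitary
    taking A to B takes u s to v s. *)
Lemma lurking_isometry (D : Type) p n (u v : D -> 'M[C]_(p, n)) :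
  (forall s t, u s *m (u t)^t* = v s *m (v t)^t*) ->
  exists2 W : 'M[C]_n, W \is unitarymx & forall s, u s *m W = v s.
Proof.
move=> uv.
pose P r := `[< exists A B : 'M[C]_(r, n), [/\ row_free A,
  A *m A^t* = B *m B^t* & forall s, A *m (u s)^t* = B *m (v s)^t*] >].
have P0 : exists r, P r.
  exists 0; apply/asboolP; exists 0, 0; split.
  - by rewrite /row_free mxrank0.
  - by rewrite !mul0mx.
  - by move=> s; rewrite !mul0mx.
have Pn r : P r -> (r <= n)%N.
  by move/asboolP=> [A [B [/eqP fA _ _]]]; rewrite -fA rank_leq_col.
case: (ex_maxnP P0 Pn) => r /asboolP[A [B [fA AB ABuv]]] rmax.
(* A row of u s outside the span of A could be appended to A. *)
have span s : (u s <= A)%MS.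
  apply/row_subP=> i; apply/negPn/negP=> uA.
  suff /rmax : P (r + 1)%N by rewrite addn1 ltnn.
  apply/asboolP; exists (col_mx A (row i (u s))), (col_mx B (row i (v s))).
  have ABi : row i (u s) *m A^t* = row i (v s) *m B^t*.
    have := congr1 (fun X => row i (X^t*)) (ABuv s).
    by rewrite !adjmx_mul !trmxCK !row_mul.
  have ABi' : A *m (row i (u s))^t* = B *m (row i (v s))^t*.
    have := congr1 (fun X => X^t*) ABi.
    by rewrite !adjmx_mul !trmxCK.
  split.
  - rewrite /row_free -addsmxE eqn_leq; apply/andP; split.
      by rewrite addsmxE rank_leq_row.
    rewrite addn1 -{1}(eqP fA) ltnNge; apply: contra uA => le.
    apply: submx_trans (addsmxSr A _) _.
    by rewrite -(mxrank_leqif_sup (addsmxSl _ _)) eqn_leq le mxrankS ?addsmxSl.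
  - rewrite !adj_col_mx !mul_col_row AB ABi ABi'.
    congr (block_mx _ _ _ _); rewrite !rowE !adjmx_mul -!mulmxA.
    by rewrite [u s *m (_ *m _)]mulmxA [v s *m (_ *m _)]mulmxA uv.
  - by move=> t; rewrite !mul_col_mx ABuv -!row_mul uv.
have [W Wu AW] := row_free_isometry fA AB.
exists W => // s; have /submxP[X uE] := span s.
rewrite uE -mulmxA AW; apply/esym/eqP; rewrite -subr_eq0; apply/eqP/gram_eq0.
have vB : v s *m B^t* = u s *m A^t*.
  have := congr1 (fun X => X^t*) (ABuv s).
  by rewrite !adjmx_mul !trmxCK.
rewrite adjmxB adjmx_mul mulmxBl !mulmxBr -uv !mulmxA vB.
rewrite -!mulmxA -ABuv [B *m (_ *m _)]mulmxA -AB -[A *m _ *m _]mulmxA.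
by rewrite !(mulmxA X) -uE subrr.
Qed.

End Isometry.

(** * Colligations and ampliations *)

Section Colligation.
Variables (K : fieldType) (p N : nat) (g : 'M[K]_(p + N)) (E : 'M[K]_N).
Let a := ulsubmx g.
Let b := ursubmx g.
Let c := dlsubmx g.
Let d := drsubmx g.
Hypothesis dE : 1%:M - d *m E \in unitmx.
Let f := a + b *m E *m invmx (1%:M - d *m E) *m c.

Lemma mul_row_colligation (X : 'M[K]_(p, N)) :
  row_mx 1%:M X *m g = row_mx (a + X *m c) (b + X *m d).
Proof. by rewrite -[g in LHS]submxK mul_row_block !mul1mx. Qed.

(** The state is b (1 - E d)^-1, written as b + b E W d with
    W = (1 - d E)^-1, so that only 1 - d E has to be inverted. *)
Lemma colligation_state :
  exists G : 'M[K]_(p, N), row_mx 1%:M (G *m E) *m g = row_mx f G.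
Proof.
set W := invmx (1%:M - d *m E).
exists (b + b *m E *m W *m d).
have WE : 1%:M + W *m d *m E = W.
  have : W *m (1%:M - d *m E) = 1%:M by rewrite mulVmx.
  by rewrite mulmxBr mulmx1 mulmxA => <-; rewrite subrK.
have -> : (b + b *m E *m W *m d) *m E = b *m E *m W.
  by rewrite -[in RHS]WE mulmxDl mulmxDr mulmx1 !mulmxA.
by rewrite mul_row_colligation.
Qed.

(** The second block of the equation reads G (1 - E d) = b; multiplied by E on
    the right it becomes G E (1 - d E) = b E, which determines G E. *)
Lemma colligation_output (G h : 'M[K]_(p, _)) :
  row_mx 1%:M (G *m E) *m g = row_mx h G -> h = f.
Proof.
rewrite mul_row_colligation => /eq_row_mx[<- GE].
suff -> : G *m E = b *m E *m invmx (1%:M - d *m E) by [].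
apply: (canRL (mulmxK dE)); rewrite mulmxBr mulmx1.
by rewrite -{1}GE mulmxDl !mulmxA addrK.
Qed.
End Colligation.

Section Ampliation.
Variables (K : comNzRingType) (m j : nat).

Lemma sum_mxtens (V : nmodType) (F : 'I_(m * j) -> V) :
  \sum_x F x = \sum_(mu < m) \sum_(k < j) F (mxtens_index (mu, k)).
Proof.
rewrite pair_big (reindex (@mxtens_index m j)) /=.
  by apply: eq_bigr => -[].
exists (@mxtens_unindex m j) => x _; first exact: mxtens_indexK.
exact: mxtens_unindexK.
Qed.

(** A row vector of length m j is a family of j row vectors of length m, on
    each of which S (x) 1_j acts as S. *)
Definition slice p (k : 'I_j) (G : 'M[K]_(p, m * j)) : 'M[K]_(p, m) :=
  colsub (fun mu => mxtens_index (mu, k)) G.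

Lemma mul_ampliation p (k : 'I_j) (G : 'M[K]_(p, m * j)) (X : 'M[K]_m) :
  slice k (G *m (X *t (1%:M : 'M_j))) = slice k G *m X.
Proof.
apply/matrixP=> i mu; rewrite !mxE sum_mxtens; apply: eq_bigr => nu _.
rewrite (bigD1 k) //= big1 ?addr0 => [|l lk].
  by rewrite tensmxE !mxE eqxx mulr1.
by rewrite tensmxE !mxE (negPf lk) !mulr0.
Qed.

Lemma mulmx_slices p q (G : 'M[K]_(p, m * j)) (H : 'M[K]_(m * j, q)) :
  G *m H = \sum_k slice k G *m (slice k H^T)^T.
Proof.
apply/matrixP=> i l; rewrite mxE sum_mxtens exchange_big summxE /=.
by apply: eq_bigr => k _; rewrite mxE; apply: eq_bigr => mu _; rewrite !mxE.
Qed.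
End Ampliation.

(** * Resolvents of strict contractions *)

Section Contraction.
Variable C : numClosedFieldType.

Definition normsq n (v : 'cV[C]_n) : C := (v^t* *m v) 0 0.

Lemma normsqE n (v : 'cV[C]_n) : normsq v = \sum_i `|v i 0| ^+ 2.
Proof.
by rewrite /normsq mxE; apply: eq_bigr => i _; rewrite !mxE normCKC.
Qed.

Lemma normsq_ge0 n (v : 'cV[C]_n) : 0 <= normsq v.
Proof. by rewrite normsqE sumr_ge0 // => i _; rewrite exprn_ge0. Qed.

Lemma normsq_unitary n (g : 'M[C]_n) v :
  g \is unitarymx -> normsq (g *m v) = normsq v.
Proof.
move=> /unitarymxP/mulmx1C gg.
by rewrite /normsq adjmx_mul -mulmxA [g^t* *m _]mulmxA gg mul1mx.
Qed.

Lemma normsq_col_mx p q (u : 'cV[C]_p) (v : 'cV[C]_q) :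
  normsq (col_mx u v) = normsq u + normsq v.
Proof. by rewrite /normsq adj_col_mx mul_row_col mxE. Qed.

Lemma normsq_drsubmx p q (g : 'M[C]_(p + q)) v :
  g \is unitarymx -> normsq (drsubmx g *m v) <= normsq v.
Proof.
move=> gu; have := normsq_unitary (col_mx 0 v) gu.
rewrite -{1}[g]submxK mul_block_col !mulmx0 !add0r !normsq_col_mx.
rewrite [normsq 0]normsqE big1 ?add0r => [<-|i _]; first last.
  by rewrite mxE normr0 expr0n.
by rewrite lerDr normsq_ge0.
Qed.

Lemma normsq_slices m j (v : 'cV[C]_(m * j)) :
  normsq v = \sum_k normsq (slice k v^T)^T.
Proof.
rewrite normsqE sum_mxtens exchange_big; apply: eq_bigr => k _.
by rewrite normsqE; apply: eq_bigr => mu _; rewrite !mxE.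
Qed.

(** A vector v fixed by d E would satisfy |v| = |d E v| <= |E v|, because d is
    a block of a unitary matrix; but |E v| < |v|, slice by slice. *)
Lemma resolvent_unit p m j (g : 'M[C]_(p + m * j)) (S : 'M[C]_m) :
  (forall v : 'cV[C]_m, v != 0 -> normsq (S *m v) < normsq v) ->
  g \is unitarymx ->
  1%:M - drsubmx g *m (S *t (1%:M : 'M_j)) \in unitmx.
Proof.
move=> Sc gu; set E := S *t _; apply/negPn/negP => nu.
have [v v0 vE] : exists2 v : 'cV[C]_(m * j), v != 0 & v = drsubmx g *m (E *m v).
  move: nu; rewrite -unitmx_tr -row_free_unit -kermx_eq0 => /rowV0Pn[x].
  move=> /sub_kermxP x0 xn0; exists x^T; first by rewrite trmx_eq0.
  apply/eqP; rewrite -subr_eq0 mulmxA -[X in X - _]mul1mx -mulmxBl.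
  by rewrite -[X in X *m _]trmxK -trmx_mul x0 trmx0.
have slE k : (slice k (E *m v)^T)^T = S *m (slice k v^T)^T.
  by rewrite trmx_mul trmx_tens trmx1 mul_ampliation trmx_mul trmxK.
have leS k : normsq (S *m (slice k v^T)^T) <= normsq (slice k v^T)^T.
  have [->|/Sc/ltW//] := eqVneq ((slice k v^T)^T) 0; by rewrite mulmx0.
suff : normsq (E *m v) < normsq v.
  by move=> /lt_geF; rewrite {1}vE normsq_drsubmx.
have [k vk] : exists k, (slice k v^T)^T != 0.
  have /cV0Pn[x vx] := v0; move: vx; case: (mxtens_indexP x) => mu k vx.
  by exists k; apply/cV0Pn; exists mu; rewrite !mxE.
rewrite !normsq_slices (bigD1 k) //= [X in _ < X](bigD1 k) //=.
rewrite ltr_leD ?slE ?Sc //; apply: ler_sum => l _; by rewrite slE.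
Qed.
End Contraction.

(** * Characteristic functions and Agler decompositions *)

Lemma addr_eqB (V : zmodType) (x y z w : V) :
  x + y = z + w <-> x - z = w - y.
Proof.
split=> e; last by rewrite -[x](subrK z) e addrAC subrK addrC.
by rewrite -[x](addrK y) e addrAC [z + w]addrC addrK.
Qed.

Section Agler.
Variables (C : numClosedFieldType) (D : Type) (m : nat) (Z : D -> 'M[C]_m).

(** The family H is indexed by a finite type rather than by an ordinal, so that
    sums and products of decompositions need no renumbering.  Its cardinal is
    the number j of the characteristic function built from it. *)
Definition agler p (F : D -> 'M[C]_p) := exists (J : finType)
  (H : J -> D -> 'M[C]_(p, m)), forall S T,
  1%:M - F S *m (F T)^t* =
  \sum_k H k S *m (1%:M - Z S *m (Z T)^t*) *m (H k T)^t*.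

Lemma gram_slices p j (G H : 'M[C]_(p, m * j)) S T :
  let E S := Z S *t (1%:M : 'M[C]_j) in
  G *m H^t* - (G *m E S) *m (H *m E T)^t* =
  \sum_k slice k G *m (1%:M - Z S *m (Z T)^t*) *m (slice k H)^t*.
Proof.
have slicesE (A B : 'M[C]_(p, m * j)) :
    A *m B^t* = \sum_k slice k A *m (slice k B)^t*.
  rewrite mulmx_slices; apply: eq_bigr => k _; congr (_ *m _).
  by apply/matrixP=> mu i; rewrite !mxE.
move=> E; rewrite !slicesE -sumrB; apply: eq_bigr => k _.
by rewrite !mul_ampliation adjmx_mul mulmxBr mulmx1 mulmxBl !mulmxA.
Qed.

Hypothesis Zc : forall S (v : 'cV[C]_m), v != 0 -> normsq (Z S *m v) < normsq v.

(** The function [Theta] of g, over an arbitrary C and along the family Z. *)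
Definition transfer p j (g : 'M[C]_(p + m * j)) (S : D) :=
  ulsubmx g + ursubmx g *m (Z S *t (1%:M : 'M_j)) *m
  invmx (1%:M - drsubmx g *m (Z S *t (1%:M : 'M_j))) *m dlsubmx g.

(** The Gram matrices of (1, G E) and of (1, G E) g = (F, G) agree since g is
    unitary. *)
Lemma agler_transfer p j (g : 'M[C]_(p + m * j)) :
  g \is unitarymx -> agler (transfer g).
Proof.
move=> gu; have /choice[G GE] S := colligation_state (resolvent_unit (Zc S) gu).
exists 'I_j, (fun k S => slice k (G S)) => S T.
rewrite -gram_slices.
have : (row_mx 1%:M (G S *m (Z S *t 1%:M)) *m g) *m
  (row_mx 1%:M (G T *m (Z T *t 1%:M)) *m g)^t* =
   row_mx (transfer g S) (G S) *m (row_mx (transfer g T) (G T))^t*.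
  by rewrite !GE.
rewrite (adjmx_mul _ g) mulmxA mulmxtVK // !adj_row_mx !mul_row_col.
by rewrite trmx1 map_mx1 mul1mx => /addr_eqB.
Qed.

(** The decomposition is an equality of Gram matrices between (1, G E) and
    (F, G), where G has the H k as its slices; the unitary that realizes it is
    the colligation. *)
Lemma transfer_agler p (F : D -> 'M[C]_p) : agler F ->
  exists j (g : 'M[C]_(p + m * j)), g \is unitarymx /\ F = transfer g.
Proof.
move=> [J [H FH]]; pose j := #|J|; exists j.
pose G S : 'M[C]_(p, m * j) := \matrix_(i, x)
  H (enum_val (mxtens_unindex x).2) S i (mxtens_unindex x).1.
pose E S := Z S *t (1%:M : 'M[C]_j).
have sliceG k S : slice k (G S) = H (enum_val k) S.
  by apply/matrixP=> i mu; rewrite !mxE mxtens_indexK.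
have [|g gu gE] := @lurking_isometry C D p (p + m * j)
  (fun S => row_mx 1%:M (G S *m E S)) (fun S => row_mx (F S) (G S)).
  move=> S T; rewrite !adj_row_mx !mul_row_col trmx1 map_mx1 mul1mx.
  apply/addr_eqB; rewrite FH gram_slices.
  rewrite (reindex _ (onW_bij _ (enum_val_bij J))).
  by apply: eq_bigr => k _; rewrite !sliceG.
exists g; split=> //; apply/funext => S.
by have := colligation_output (resolvent_unit (Zc S) gu) (gE S).
Qed.
End Agler.

(** * The determinant of a function with an Agler decomposition *)

Lemma prodrB_telescope (K : comPzRingType) n (a b : 'I_n -> K) :
  \prod_i b i - \prod_i a i = \sum_(k < n)
    (\prod_(i < n) if (i < k)%N then a i else if i == k then 1 else b i)
      * (b k - a k).
Proof.
pose t (k : nat) := \prod_(i < n) if (i < k)%N then a i else b i.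
have -> : \prod_i b i - \prod_i a i = - (t n - t 0%N).
  by rewrite opprB; congr (_ - _); apply: eq_bigr => i _; rewrite ?ltn_ord.
rewrite -telescope_sumr // big_mkord -sumrN; apply: eq_bigr => k _.
rewrite opprB /t (bigD1 k) //= [X in _ - X](bigD1 k) //=.
rewrite [in RHS](bigD1 k) //= ltnn ltnSn eqxx mul1r mulrC [X in _ - X]mulrC.
rewrite [RHS]mulrBr; congr (_ * _ - _ * _); apply: eq_bigr => i ik.
  by rewrite (negPf ik).
by rewrite (negPf ik) ltnS leq_eqVlt (inj_eq val_inj) (negPf ik).
Qed.

(** Antisymmetrizing both in the rows and in the columns, rather than in one of
    them, counts the determinant n! times, but gives a sum that is
    symmetric in s and t and hence can be read as a Gram product. *)
Lemma sum_perm2_det (K : comPzRingType) n (X : 'M[K]_n) :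
  \sum_(s : 'S_n) \sum_(t : 'S_n)
    (-1) ^+ s * (-1) ^+ t * \prod_i X (s i) (t i) = n`!%:R * \det X.
Proof.
transitivity (\sum_(s : 'S_n) \det X); last first.
  rewrite mulr_natl -card_Sn -sumr_const; apply: eq_bigl => s.
  by rewrite inE.
apply: eq_bigr => s _.
transitivity ((-1) ^+ s * \det (row_perm s X)).
  rewrite big_distrr; apply: eq_bigr => t _ /=; rewrite mulrA; congr (_ * _).
  by apply: eq_bigr => i _; rewrite mxE.
by rewrite row_permE det_mulmx det_perm mulrA -expr2 sqrr_sign mul1r.
Qed.

Lemma sesqui_sum (C : numClosedFieldType) (I : finType) m
    (N : 'M[C]_m) (x y : I -> C) (u v : I -> 'rV[C]_m) :
  ((\sum_s x s *: u s) *m N *m (\sum_t y t *: v t)^t*) 0 0 =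
  \sum_s \sum_t x s * Num.conj (y t) * (u s *m N *m (v t)^t*) 0 0.
Proof.
have -> : (\sum_t y t *: v t)^t* = \sum_t Num.conj (y t) *: (v t)^t*.
  rewrite linear_sum raddf_sum; apply: eq_bigr => t _ /=.
  by rewrite linearZ /= map_mxZ.
rewrite !mulmx_suml summxE; apply: eq_bigr => s _.
rewrite mulmx_sumr summxE; apply: eq_bigr => t _.
by rewrite -scalemxAr -!scalemxAl scalerA mxE [Num.conj (y t) * _]mulrC.
Qed.

Lemma mul_row_adj (C : numClosedFieldType) p m (A B : 'M[C]_(p, m)) N i j :
  (row i A *m N *m (row j B)^t*) 0 0 = (A *m N *m B^t*) i j.
Proof.
rewrite -row_mul !mxE; apply: eq_bigr => k _; rewrite !mxE.
by congr (_ * _); apply: eq_bigr.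
Qed.

Section DetAgler.
Variables (C : numClosedFieldType) (D : Type) (m : nat) (Z : D -> 'M[C]_m).
Variables (n : nat) (F : D -> 'M[C]_n).

(** The factors of the k-th telescoping term.  The matrix in position k has ones
    in its column k and zeros elsewhere: all entries of its Gram matrix are 1,
    so that position k can be kept in the product and w below can range over
    all functions. *)
Definition mixed_factor (k i : 'I_n) (S : D) : 'M[C]_n :=
  if (i < k)%N then F S else
  if i == k then \matrix_(p, w) (w == k)%:R else 1%:M.

(** The s-th term in the Leibniz expansion of the determinant whose i-th column
    is column w i of [mixed_factor k i S]. *)
Definition mixed_coef (k : 'I_n) (w : {ffun 'I_n -> 'I_n}) (S : D) (s : 'S_n) :=
  (-1) ^+ s * \prod_i mixed_factor k i S (s i) (w i).

Lemma sum_mixed_coef k S T s t :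
  \sum_w mixed_coef k w S s * Num.conj (mixed_coef k w T t) =
  (-1) ^+ s * (-1) ^+ t *
  \prod_(i < n) (if (i < k)%N then (F S *m (F T)^t*) (s i) (t i) else
              if i == k then 1 else (1%:M : 'M_n) (s i) (t i)).
Proof.
transitivity (\sum_(w : {ffun 'I_n -> 'I_n}) (-1) ^+ s * (-1) ^+ t *
    \prod_i (mixed_factor k i S (s i) (w i) *
             Num.conj (mixed_factor k i T (t i) (w i)))).
  apply: eq_bigr => w _; rewrite rmorphM rmorph_sign rmorph_prod /= mulrACA.
  by rewrite -big_split.
rewrite -big_distrr /=; congr (_ * _).
rewrite -(bigA_distr_bigA (fun i w => mixed_factor k i S (s i) w *
             Num.conj (mixed_factor k i T (t i) w))).
apply: eq_bigr => i _; rewrite /mixed_factor; case: ifP => _.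
  by rewrite mxE; apply: eq_bigr => w _; rewrite !mxE.
case: ifP => _.
  rewrite (bigD1 k) //= !mxE eqxx mul1r conjC1 big1 ?addr0 // => w wk.
  by rewrite !mxE (negPf wk) mul0r.
rewrite (bigD1 (s i)) //= !mxE eqxx mul1r conjC_nat eq_sym big1 ?addr0 //.
by move=> w ws; rewrite !mxE eq_sym (negPf ws) mul0r.
Qed.

(** The new family is indexed by a position k, an index l of the old family,
    and a choice w of columns; the product of the entries in the positions
    other than k multiplies a row of H l, and the result is antisymmetrized.
    The square root of 1/n! in each of the two copies accounts for the n! of
    [sum_perm2_det]. *)
Lemma agler_det : agler Z F -> agler Z (fun S => (\det (F S))%:M : 'M_1).
Proof.
move=> [J [H FH]].
pose c : C := sqrtC (n`!%:R)^-1.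
have cc : c * Num.conj c = n`!%:R^-1.
  rewrite /c conj_Creal ?realE ?sqrtC_ge0 ?invr_ge0 ?ler0n //.
  by rewrite -expr2 sqrtCK.
pose h (x : 'I_n * J * {ffun 'I_n -> 'I_n}) S : 'rV[C]_m :=
  c *: \sum_s mixed_coef x.1.1 x.2 S s *: row (s x.1.1) (H x.1.2 S).
exists _, h => S T.
pose N := 1%:M - Z S *m (Z T)^t*.
apply/matrixP=> i0 j0; rewrite !ord1 {i0 j0}.
pose A := F S *m (F T)^t*.
have hE k l w : (h (k, l, w) S *m N *m (h (k, l, w) T)^t*) 0 0 =
  n`!%:R^-1 * \sum_s \sum_t mixed_coef k w S s * Num.conj (mixed_coef k w T t)
    * (H l S *m N *m (H l T)^t*) (s k) (t k).
  rewrite /h linearZ /= map_mxZ -scalemxAr -!scalemxAl scalerA mxE mulrC -cc.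
  rewrite [_ * c]mulrC mulrC sesqui_sum; congr (_ * _).
  apply: eq_bigr => s _; apply: eq_bigr => t _; by rewrite mul_row_adj.
have detA : \det (F S) * Num.conj (\det (F T)) = \det A.
  by rewrite det_mulmx -map_trmx det_tr det_map_mx.
have n0 : n`!%:R != 0 :> C by rewrite pnatr_eq0 -lt0n fact_gt0.
transitivity (1 - \det A).
  by rewrite !mxE big_ord1 !mxE eqxx !mulr1n -detA.
transitivity (n`!%:R^-1 * \sum_(s : 'S_n) \sum_(t : 'S_n)
  (-1) ^+ s * (-1) ^+ t *
  (\prod_i (1%:M : 'M[C]_n) (s i) (t i) - \prod_i A (s i) (t i))).
  apply: (canRL (mulKf n0)).
  have -> : 1 - \det A = \det (1%:M : 'M[C]_n) - \det A by rewrite det1.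
  rewrite mulrBr -!sum_perm2_det -sumrB; apply: eq_bigr => s _.
  by rewrite -sumrB; apply: eq_bigr => t _; rewrite mulrBr.
rewrite summxE -(pair_big xpredT xpredT (fun kl w =>
  (h (kl, w) S *m N *m (h (kl, w) T)^t*) 0 0)) /=.
rewrite -(pair_big xpredT xpredT (fun k l => \sum_w
  (h (k, l, w) S *m N *m (h (k, l, w) T)^t*) 0 0)) /=.
(* Telescoping separates the position k that carries 1 - A. *)
transitivity (\sum_(k < n) n`!%:R^-1 * \sum_(s : 'S_n) \sum_(t : 'S_n)
  (-1) ^+ s * (-1) ^+ t *
  (\prod_(i < n) (if (i < k)%N then A (s i) (t i) else
     if i == k then 1 else (1%:M : 'M_n) (s i) (t i))) *
  (1%:M - A) (s k) (t k)).
  rewrite -big_distrr /=; congr (_ * _).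
  rewrite [RHS]exchange_big; apply: eq_bigr => s _ /=.
  rewrite [RHS]exchange_big; apply: eq_bigr => t _ /=.
  rewrite prodrB_telescope big_distrr /=; apply: eq_bigr => k _.
  by rewrite mulrA !mxE.
apply: eq_bigr => k _.
under eq_bigr => l _ do under eq_bigr => w _ do rewrite hE.
under eq_bigr => l _ do rewrite -big_distrr.
rewrite -big_distrr /=; congr (_ * _).
under eq_bigr => l _ do rewrite exchange_big /=.
rewrite [RHS]exchange_big; apply: eq_bigr => s _ /=.
under eq_bigr => l _ do rewrite exchange_big /=.
rewrite [RHS]exchange_big; apply: eq_bigr => t _ /=.
rewrite /A FH summxE big_distrr; apply: eq_bigr => l _ /=.
by rewrite -sum_mixed_coef big_distrl.
Qed.
End DetAgler.

(** * Points of the ball are strict contractions *)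

Section Ball.
Variable R : realType.
Local Notation C := R[i].

Lemma l2norm_normsq n (v : 'cV[C]_n) :
  real_complex R (l2norm v ^+ 2) = normsq v.
Proof.
rewrite normsqE sqr_sqrtr ?sumr_ge0 // => [|i _]; last exact: sqr_ge0.
rewrite rmorph_sum; apply: eq_bigr => i _ /=.
by rewrite rmorphXn.
Qed.

Lemma l2norm_ge0 n (v : 'cV[C]_n) : 0 <= l2norm v.
Proof. exact: sqrtr_ge0. Qed.

(** Without this bound the supremum defining the operator norm could take a
    default value, and opnorm z < 1 would not control z.  Entries of a unit
    vector have modulus at most 1, hence the bound in terms of row sums. *)
Lemma opnorm_has_ubound n (z : 'M[C]_n) :
  has_ubound [set l2norm (z *m v) | v in [set v | l2norm v <= 1]].
Proof.
exists (Num.sqrt (\sum_i (\sum_j Normc.normc (z i j)) ^+ 2)).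
move=> _ [v /= v1 <-]; apply: ler_wsqrtr; apply: ler_sum => i _.
have nc0 (x : C) : 0 <= Normc.normc x by case: x => a b; exact: sqrtr_ge0.
have vj j : Normc.normc (v j 0) <= 1.
  apply: le_trans v1; rewrite -[X in X <= _]ger0_norm // -sqrtr_sqr.
  apply: ler_wsqrtr; rewrite (bigD1 j) //= lerDl.
  by apply: sumr_ge0 => k _; exact: sqr_ge0.
rewrite lerXn2r ?nnegrE ?sumr_ge0 // mxE.
rewrite -lecR rmorph_sum -[X in X <= _]/(`|\sum_j z i j * v j 0|).
apply: le_trans (ler_norm_sum _ _ _) _; apply: ler_sum => j _.
rewrite -[X in _ <= X]/(`|z i j|) normrM ler_piMr //.
by rewrite -[X in X <= _]/(real_complex R (Normc.normc (v j 0))) lecR.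
Qed.

Lemma l2normZ n (c : R) (w : 'cV[C]_n) :
  0 <= c -> l2norm (real_complex R c *: w) = c * l2norm w.
Proof.
move=> c0; rewrite /l2norm -[in RHS](ger0_norm c0) -sqrtr_sqr.
rewrite -sqrtrM ?sqr_ge0 //.
congr Num.sqrt; rewrite mulr_sumr; apply: eq_bigr => i _.
rewrite mxE Normc.normcM exprMn; congr (_ * _).
by rewrite sqr_sqrtr ?addr_ge0 ?sqr_ge0 //= expr0n addr0.
Qed.

Lemma l2norm_gt0 n (v : 'cV[C]_n) : v != 0 -> 0 < l2norm v.
Proof.
move=> v0; rewrite lt0r l2norm_ge0 andbT; apply: contra v0 => /eqP lv0.
have /gram_eq0 : v^t* *m (v^t*)^t* = 0.
  apply/matrixP=> i j; rewrite !ord1 trmxCK -[LHS]/(normsq v) mxE.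
  by rewrite -l2norm_normsq lv0 expr0n.
by move=> /(congr1 (fun X => X^t*)); rewrite trmxCK trmx0 map_mx0 => ->.
Qed.

(** The bound on the unit ball extends to all v by scaling. *)
Lemma ball_contraction n (z : 'M[C]_n) (v : 'cV[C]_n) :
  Bset R n z -> v != 0 -> normsq (z *m v) < normsq v.
Proof.
rewrite /Bset /= => z1 v0; rewrite -!l2norm_normsq ltcR.
rewrite ltrXn2r ?l2norm_ge0 //.
have v_gt0 := l2norm_gt0 v0.
have c_ge0 : 0 <= (l2norm v)^-1 by rewrite invr_ge0 ltW.
pose u := real_complex R (l2norm v)^-1 *: v.
have : l2norm (z *m u) <= opnorm z.
  apply: ub_le_sup; first exact: opnorm_has_ubound.
  by exists u => //=; rewrite l2normZ // mulVf ?gt_eqF.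
move=> /le_lt_trans/(_ z1); rewrite -scalemxAr l2normZ // mulrC.
by rewrite ltr_pdivrMr // mul1r.
Qed.
End Ball.

(* A scalar-valued function is read as a function with values in 1 x 1
   matrices, through x |-> x%:M. *)
Theorem corollary1p7 (R : realType) (m alpha : nat)
    (hm : (0 < m)%N) (halpha : (0 < alpha)%N)
    (F : Bset R m -> 'M[R[i]]_alpha) (hF : Char R m alpha F) :
  Char R m 1 (fun S => (\det (F S))%:M).
Proof.
have Zc (S : Bset R m) (v : 'cV_m) : v != 0 -> normsq (\val S *m v) < normsq v.
  by apply: ball_contraction; apply: set_mem; exact: valP.
case: hF => j [g [gu ->]].
have [j' [g' [g'u detE]]] :=
  transfer_agler Zc (agler_det (agler_transfer Zc gu)).
by exists j', g'; split.
Qed.
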